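(* Let $n\ge 2$, and let $\mathcal{F}$ be either $\mathrm{RG}(n)$ or $\mathrm{RG}(n,k)$ for some $1\le k\le n$. Let $\pi$ be a permutation of $\{2,3,\dots,n\}$. Under the action of $\mathbf{w}_\pi$ on $\mathcal{F}$, the statistic $I_{i\mapsto 1}-I_{j\mapsto 1}$ is $0$-mesic for any $i,j\in\{2,3,\dots,n\}$; that is, for every $\mathbf{w}_\pi$-orbit $O\subseteq\mathcal{F}$, $$\frac{1}{\#O}\sum_{f\in O}\bigl(I_{i\mapsto 1}(f)-I_{j\mapsto 1}(f)\bigr)=0.$$
   Context: Notation: $[n]=\{1,\dots,n\}$. Given a set partition of $[n]$ with $k$ blocks, order the blocks by increasing least element; its restricted growth word (RG-word) is the function $f$ on $[n]$ with $f(i)=j$ if $i$ is in the $j$-th block. $\mathrm{RG}(n,k)$ is the set of RG-words of partitions of $[n]$ into exactly $k$ blocks, regarded as functions $[n]\to[k]$; equivalently, the surjections $f:[n]\to[k]$ with $\min f^{-1}(j)<\min f^{-1}(j+1)$ for all $1\le j\le k-1$. $\mathrm{RG}(n)$ is the set of RG-words of all partitions of $[n]$, regarded as functions $[n]\to[n]$. Whirling: for a family $\mathcal{F}$ of functions $[n]\to[K]$ and $i\in[n]$, the map $w_i:\mathcal{F}\to\mathcal{F}$ sends $f$ to the function obtained by repeatedly adding $1$ modulo $K$ to the value of $f$ at $i$ (residues represented in $[K]$, all other values unchanged, at least one addition performed), stopping the first time the resulting function is in $\mathcal{F}$. Here $K=k$ for $\mathcal{F}=\mathrm{RG}(n,k)$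 and $K=n$ for $\mathcal{F}=\mathrm{RG}(n)$. Each $w_i$ is a bijection. For a permutation $\pi$ of $\{2,\dots,n\}$, $\mathbf{w}_\pi=w_{\pi(n)}\circ\cdots\circ w_{\pi(3)}\circ w_{\pi(2)}$ (so $w_{\pi(2)}$ is applied first). $I_{i\mapsto 1}(f)=1$ if $f(i)=1$ and $I_{i\mapsto 1}(f)=0$ otherwise. A statistic is $c$-mesic under an invertible map with finite orbits if its average over every orbit equals $c$. *)

(* Defs.v *)
From mathcomp Require Import all_boot all_order all_algebra all_fingroup.

Set Implicit Arguments.
Unset Strict Implicit.
Unset Printing Implicit Defensive.

Import GRing.Theory.

(** Conventions: the element m of [n] = {1, ..., n} is represented by the
    ordinal m - 1 of 'I_n, for positions as well as for values of words.  So
    the position 1 and the value 1 are the ordinal with value 0, and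
    {2, ..., n} is [set x : 'I_n | 0 < x]. *)

Section RGWords.

Variable n : nat.

Definition least (B : {set 'I_n}) : nat := \big[minn/n]_(x in B) (x : nat).

Definition ordered_blocks (P : {set {set 'I_n}}) : seq {set 'I_n} :=
  sort (fun A B => least A <= least B) (enum P).

Definition is_RG_word_of (K : nat) (P : {set {set 'I_n}})
    (f : {ffun 'I_n -> 'I_K}) : bool :=
  [forall i, (f i : nat) == index (pblock P i) (ordered_blocks P)].

Definition RG : {set {ffun 'I_n -> 'I_n}} :=
  [set f | [exists P, partition P [set: 'I_n] && is_RG_word_of P f]].

Definition RGk (k : nat) : {set {ffun 'I_n -> 'I_k}} :=
  [set f | [exists P, [&& partition P [set: 'I_n], #|P| == k
                        & is_RG_word_of P f]]].

End RGWords.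

Section Whirling.

Variables (n K : nat) (F : {set {ffun 'I_n -> 'I_K}}).

Definition incr (i : 'I_n) (f : {ffun 'I_n -> 'I_K}) : {ffun 'I_n -> 'I_K} :=
  [ffun x => if x == i then ordS (f x) else f x].

(** The first member of F among incr i f, ..., incr i^K f = f; since f is in F
    there is one, and the default value of head is never used. *)
Definition whirl_fun (i : 'I_n) (f : {f | f \in F}) : {f | f \in F} :=
  head f (pmap insub (traject (incr i) (incr i (val f)) K)).

Lemma incr_inj i : injective (incr i).
Proof.
move=> f g /ffunP E; apply/ffunP => x; move: (E x); rewrite !ffunE.
by case: ifP => // _; apply: (bij_inj (@ordS_bij K)).
Qed.

Lemma val_iter_ordS m (x : 'I_K) : iter m (@ordS K) x = (x + m) %% K :> nat.
Proof.
elim: m => [|m IH] /=; first by rewrite addn0 modn_small.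
by rewrite IH -addn1 modnDml addn1 addnS.
Qed.

Lemma iter_incrE m i f :
  iter m (incr i) f =
  [ffun x => if x == i then iter m (@ordS K) (f x) else f x].
Proof.
elim: m => [|m IH] /=; first by apply/ffunP => x; rewrite ffunE; case: ifP.
by rewrite IH; apply/ffunP => x; rewrite !ffunE; case: (x == i).
Qed.

Lemma iter_incr_period i f : iter K (incr i) f = f.
Proof.
rewrite iter_incrE; apply/ffunP => x; rewrite ffunE; case: ifP => // _.
by apply: val_inj; rewrite [LHS]val_iter_ordS modnDr modn_small.
Qed.

Lemma head_pmap_traject p i g (d : {f | f \in F}) :
    (exists2 m, 0 < m <= p & iter m (incr i) g \in F) ->
  exists m, [/\ 0 < m,
    val (head d (pmap insub (traject (incr i) (incr i g) p))) =
      iter m (incr i) g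
    & forall l, 0 < l < m -> iter l (incr i) g \notin F].
Proof.
elim: p g => [|p IH] g [m m_le]; first by case: m m_le => [|m] /andP[].
rewrite /=; case: insubP => [u _ uE|gF] /= mF.
  by exists 1; split=> // -[|[|l]].
have [|q [q_gt0 qE qmin]] := IH (incr i g).
  move: m m_le mF gF => [|[|m]] // m_le mF gF; first by rewrite mF in gF.
  by exists m.+1; rewrite // -iterSr.
exists q.+1; split=> //; first by rewrite qE iterSr.
by case=> [|[|l]] // /andP[_]; rewrite ltnS iterSr => lq; apply: qmin.
Qed.

Lemma whirl_funP i f : exists m,
  [/\ 0 < m, val (whirl_fun i f) = iter m (incr i) (val f)
    & forall l, 0 < l < m -> iter l (incr i) (val f) \notin F].
Proof.
apply: head_pmap_traject; exists K; last by rewrite iter_incr_period (valP f).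
by rewrite leqnn andbT; case: (val f i) => x; apply: leq_ltn_trans.
Qed.

Lemma whirl_fun_inj i : injective (whirl_fun i).
Proof.
move=> f g E.
have [a [a0 aE amin]] := whirl_funP i f; have [b [b0 bE bmin]] := whirl_funP i g.
have {E aE bE} E : iter a (incr i) (val f) = iter b (incr i) (val g).
  by rewrite -aE -bE E.
wlog le_ab : f g a b a0 b0 amin bmin E / a <= b.
  move=> H; case/orP: (leq_total a b) => h; first exact: (H f g a b).
  exact/esym/(H g f b a).
have inj_it m : injective (iter m (incr i)).
  by elim: m => [|m IH] x y //= /incr_inj /IH.
move: E; rewrite -{1}(subnKC le_ab) iterD => /inj_it E.
move: le_ab; rewrite leq_eqVlt => /orP[/eqP ab | lt_ab].
  by apply: val_inj; rewrite E ab subnn.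
have := bmin (b - a); rewrite -E (valP f) subn_gt0 lt_ab ltn_subrL a0 b0.
by move=> /(_ isT).
Qed.

Definition whirl (i : 'I_n) : {perm {f | f \in F}} := perm (@whirl_fun_inj i).

(** Products of permutations apply the leftmost factor first, so this is
    w_pi(n) \o ... \o w_pi(3) \o w_pi(2). *)
Definition whirl_word (pi : {perm 'I_n}) : {perm {f | f \in F}} :=
  (\prod_(x < n | (0 < x)%N) whirl (pi x))%g.

End Whirling.

Definition homomesic (T : finType) (w : {perm T}) (st : T -> rat) (c : rat) :
    Prop :=
  forall O : {set T}, O \in porbits w ->
    ((#|O|%:R)^-1 * \sum_(f in O) st f)%R = c.

Definition I_to1 (n K : nat) (i : 'I_n) (f : {ffun 'I_n -> 'I_K}) : rat :=
  if (f i : nat) == 0 then 1%R else 0%R.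

(* Main.v *)
Require Import Defs.
From mathcomp Require Import all_boot all_order all_algebra all_fingroup.
From mathcomp Require Import zify ring.

(** Values are counted from 0.  A function f is an RG-word iff every value
    smaller than f x is attained at some position before x.  Take adjacent
    positions i and i + 1, both positive, put a = f i and b = f (i + 1), and let
    a', b' be the new values after whirling at i, respectively at i + 1.  Then
      [a' = 0] = [a' <= b] - [a < b]   and   [b' = 0] = [a <= b] - [a < b'].
    No other whirl changes a or b, so over one round of the whirling word these
    terms telescope: the difference of the indicators at i and i + 1 is a
    coboundary Phi (w f) - Phi f, where Phi f is [a < b] or [a <= b] according
    to which of the two positions is whirled first.  It thus sums to 0 over each
    orbit, and arbitrary positions are linked through adjacent ones. *)

Set Implicit Arguments.
Unset Strict Implicit.
Unset Printing Implicit Defensive.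

Import Order.TTheory GRing.Theory.

(** * Restricted growth functions *)

Definition restricted_growth n (f : 'I_n -> nat) : Prop :=
  forall (x : 'I_n) v, v < f x -> exists2 y : 'I_n, y < x & f y = v.

(* The flag s is false for RG(n) and true for RG(n, k). *)
Definition rg_member n K (s : bool) (f : {ffun 'I_n -> 'I_K}) : Prop :=
  restricted_growth (fun x => f x) /\ (s -> forall v, exists y, f y = v).

(** The level sets determine such a function: at a first disagreement [x], the smaller of the two
    values was already taken by the other function at some earlier [y]; both functions agree at [y],
    so only one of them identifies [x] with [y]. *)
Lemma restricted_growth_eq n (f g : 'I_n -> nat) :
    restricted_growth f -> restricted_growth g ->
    (forall x y, (f x == f y) = (g x == g y)) -> f =1 g.
Proof.
move=> rf rg E.
suff H m (x : 'I_n) : x < m -> f x = g x by move=> x; apply: (H x.+1).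
elim: m x => // m IH x; rewrite ltnS => xm.
case: (ltngtP (f x) (g x)) => // lt.
  have [y yx gy] := rg x _ lt; have fy := IH y (leq_trans yx xm).
  by move: (E y x); rewrite fy gy eqxx => /esym/eqP gx; rewrite gx ltnn in lt.
have [y yx fy] := rf x _ lt; have gy := IH y (leq_trans yx xm).
by move: (E y x); rewrite -gy fy eqxx => /eqP fx; rewrite fx ltnn in lt.
Qed.

Lemma uniq_split_notin (T : eqType) (r1 r2 r3 : seq T) (p q x : T) :
    uniq (r1 ++ p :: r2 ++ q :: r3) -> x \in [:: p; q] ->
  [/\ x \notin r1, x \notin r2 & x \notin r3].
Proof.
move=> /count_uniq_mem => /(_ x); rewrite !inE count_cat /= count_cat /=.
move=> cE /orP xpq.
have c0 : (p == x) + (q == x) > 0 by case: xpq => /eqP->; rewrite eqxx; lia.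
have le1 : (x \in r1 ++ p :: r2 ++ q :: r3) <= 1 by case: (_ \in _).
by split; apply/count_memPn; lia.
Qed.

(** * Ranks of blocks ordered by least element *)

Section OrderedBlocks.

Variables (n : nat) (P : {set {set 'I_n}}).
Hypothesis partP : partition P [set: 'I_n].

Let rank (x : 'I_n) := index (pblock P x) (ordered_blocks P).

Lemma least_le (B : {set 'I_n}) (x : 'I_n) : x \in B -> least B <= x.
Proof.
move=> xB; rewrite /least -minEnat -leEnat.
exact: (bigmin_inf x).
Qed.

Lemma least_mem (B : {set 'I_n}) (x : 'I_n) : x \in B ->
  exists2 y : 'I_n, y \in B & y = least B :> nat.
Proof.
move=> xB; rewrite /least -minEnat.
rewrite (bigmin_eq_arg _ x) // => [|i _]; last by rewrite leEnat ltnW.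
by case: arg_minP => // y yB _; exists y.
Qed.

Lemma mem_ordered_blocks (B : {set 'I_n}) : (B \in ordered_blocks P) = (B \in P).
Proof. by rewrite mem_sort mem_enum. Qed.

Lemma size_ordered_blocks : size (ordered_blocks P) = #|P|.
Proof. by rewrite size_sort -cardE. Qed.

Lemma pblock_in x : pblock P x \in P.
Proof. by rewrite pblock_mem // (cover_partition partP). Qed.

Lemma rank_lt x : rank x < #|P|.
Proof.
by rewrite -size_ordered_blocks /rank index_mem mem_ordered_blocks pblock_in.
Qed.

Lemma rank_eq x y : (rank x == rank y) = (pblock P x == pblock P y).
Proof.
apply/eqP/eqP => [|E]; last by rewrite /rank E.
by apply: (index_inj set0); rewrite mem_ordered_blocks pblock_in.
Qed.

Lemma rank_nth v : v < #|P| -> exists2 y : 'I_n,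
  rank y = v & y = least (nth set0 (ordered_blocks P) v) :> nat.
Proof.
move=> vP; set B := nth _ _ _.
have BP : B \in P by rewrite -mem_ordered_blocks mem_nth ?size_ordered_blocks.
have [x xB] : exists x, x \in B.
  by apply/set0Pn; case/and3P: partP => _ _; apply: contraNneq => <-.
have [y yB yE] := least_mem xB; exists y => //.
have tP : trivIset P by case/and3P: partP.
rewrite /rank (def_pblock tP BP yB) index_uniq ?size_ordered_blocks //.
by rewrite sort_uniq enum_uniq.
Qed.

(** The witness is the least element of block [v]. Since blocks are sorted by least element, it is
    at most the least element of the block of [x], hence at most [x]; equality would make the ranks
    equal. *)
Lemma rank_restricted_growth : restricted_growth rank.
Proof.
move=> x v vx; have vP := ltn_trans vx (rank_lt x).
have [y yv yE] := rank_nth vP; exists y => //.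
have : y <= x.
  rewrite yE (leq_trans _ (least_le (B := pblock P x) _)) //; last first.
    by rewrite mem_pblock (cover_partition partP).
  rewrite -[pblock P x](nth_index set0 (s := ordered_blocks P)); last first.
    by rewrite mem_ordered_blocks pblock_in.
  pose r (A B : {set 'I_n}) := least A <= least B.
  have rt : transitive r by move=> a b c; apply: leq_trans.
  have srt : sorted r (ordered_blocks P).
    by apply: sort_sorted => a b; apply: leq_total.
  apply: (sorted_ltn_nth rt set0 srt) => //; rewrite inE size_ordered_blocks //.
  exact: rank_lt.
rewrite leq_eqVlt => /orP[/eqP/val_inj yx|//].
by rewrite -yx yv ltnn in vx.
Qed.

End OrderedBlocks.

(** * RG-words are exactly the restricted growth functions *)

Lemma is_RG_word_preim n K (f : {ffun 'I_n -> 'I_K}) :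
    restricted_growth (fun x => f x) ->
  is_RG_word_of (preim_partition f [set: 'I_n]) f.
Proof.
move=> rf; set P := preim_partition _ _.
have pP : partition P [set: 'I_n] := preim_partitionP f _.
apply/forallP => x; apply/eqP; move: x.
(* Both [f] and the rank in its partition into fibres have restricted growth, with the same level
   sets. *)
apply: (restricted_growth_eq rf (rank_restricted_growth pP)) => x y.
rewrite (rank_eq pP) eq_pblock ?(cover_partition pP) //; last by case/and3P: pP.
by rewrite pblock_equivalence_partition ?inE //; split=> // /eqP ->.
Qed.

Lemma RG_memberP n (f : {ffun 'I_n -> 'I_n}) :
  f \in RG n <-> rg_member false f.
Proof.
rewrite inE; split=> [/existsP[P /andP[pP /forallP fP]]|[rf _]].
  split=> // x v; rewrite (eqP (fP x)) => /(rank_restricted_growth pP)[y yx yv].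
  by exists y; rewrite ?(eqP (fP y)).
apply/existsP; exists (preim_partition f [set: 'I_n]).
by rewrite preim_partitionP is_RG_word_preim.
Qed.

Lemma RGk_memberP n k (f : {ffun 'I_n -> 'I_k}) :
  f \in RGk n k <-> rg_member true f.
Proof.
rewrite inE; split=> [/existsP[P /and3P[pP /eqP cP /forallP fP]]|[rf sf]].
  split=> [x v|_ v].
    rewrite (eqP (fP x)) => /(rank_restricted_growth pP)[y yx yv].
    by exists y; rewrite ?(eqP (fP y)).
  have [|y yv _] := rank_nth pP (v := v); first by rewrite cP.
  by exists y; apply: val_inj; rewrite /= (eqP (fP y)).
apply/existsP; exists (preim_partition f [set: 'I_n]).
have pP := preim_partitionP f [set: 'I_n]; have fP := is_RG_word_preim rf.
rewrite pP fP /= andbT; move/forallP: fP; set P := preim_partition _ _ => fP.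
(* With fewer than [k] blocks the value [#|P|] would be attained by no rank; with more, some rank
   would equal [k], which is not in ['I_k]. *)
case: (ltngtP #|P| k) => // lt.
  have [y yE] := sf isT (Ordinal lt).
  by have := rank_lt pP y; rewrite -(eqP (fP y)) yE /= ltnn.
have [y yE _] := rank_nth pP lt.
by have := ltn_ord (f y); rewrite (eqP (fP y)) yE ltnn.
Qed.

(** * Admissible changes of a single value *)

Definition upd n K (f : {ffun 'I_n -> 'I_K}) p u : {ffun 'I_n -> 'I_K} :=
  [ffun x => if x == p then u else f x].

Section Update.

Variables (n K : nat) (s : bool).
Implicit Types (f : {ffun 'I_n -> 'I_K}) (p y : 'I_n) (u c : 'I_K).

(** The earlier occurrence [y] replaces [p] wherever [p] served as a witness for its old value, and
    also witnesses the one value newly required before [p]. *)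
Lemma rg_member_upd_succ f p y u : rg_member s f -> y < p -> f y = f p ->
  u = (f p).+1 :> nat -> rg_member s (upd f p u).
Proof.
move=> [rf sf] yp fyp uE.
have ypN : y != p by apply: contraTneq yp => ->; rewrite ltnn.
split=> [x v|s1 v].
  rewrite ffunE; case: eqP => [->|_ vx]; last first.
    have [z zx zv] := rf x v vx.
    have [zp|zp] := eqVneq z p; last by exists z; rewrite // ffunE (negPf zp).
    exists y; first by rewrite (ltn_trans yp) // -zp.
    by rewrite ffunE (negPf ypN) fyp -zp.
  rewrite uE ltnS leq_eqVlt => /orP[/eqP ->|vp].
    by exists y; rewrite // ffunE (negPf ypN) fyp.
  have [z zp zv] := rf p v vp; exists z => //; rewrite ffunE ifN //.
  by apply: contraTneq zp => ->; rewrite ltnn.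
have [z zv] := sf s1 v; have [zp|zp] := eqVneq z p.
  by exists y; rewrite ffunE (negPf ypN) fyp -zp.
by exists z; rewrite ffunE (negPf zp).
Qed.

(** The value 0 requires nothing before it, and [y] replaces [p] as an occurrence of [c]. Allowing
    [y = p.+1] lets the right neighbour play this role. *)
Lemma rg_member_upd0 f p y u c : rg_member s (upd f p c) ->
  y != p -> y <= p.+1 -> f y = c -> u = 0 :> nat -> rg_member s (upd f p u).
Proof.
move=> [rf sf] ypN yp fy uE; split=> [x v|s1 v].
  rewrite ffunE; case: eqP => [->|/eqP xp vx]; first by rewrite uE.
  have [|z zx] := rf x v; first by rewrite ffunE (negPf xp).
  rewrite ffunE; have [zp|zp zv] := eqVneq z p; last first.
    by exists z; rewrite // ffunE (negPf zp).
  move=> cv; exists y; last by rewrite ffunE (negPf ypN) fy.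
  (* Here [p < x] gives [y <= x], and [y = x] fails because the value at [x] exceeds [c]. *)
  rewrite ltn_neqAle (leq_trans yp) -?zp // andbT.
  by apply: contraTneq vx => /val_inj <-; rewrite fy cv ltnn.
have [z] := sf s1 v; rewrite ffunE; have [_ cv|zp zv] := eqVneq z p.
  by exists y; rewrite ffunE (negPf ypN) fy.
by exists z; rewrite ffunE (negPf zp).
Qed.

End Update.

(** * Where a single whirl stops *)

Section WhirlStep.

Variables (n K : nat) (F : {set {ffun 'I_n -> 'I_K}}).
Implicit Types (f : {f | f \in F}) (p : 'I_n) (u : 'I_K).

Lemma whirl_updE p f : val (whirl F p f) = upd (val f) p (val (whirl F p f) p).
Proof.
rewrite permE; have [m [_ -> _]] := whirl_funP p f.
by rewrite iter_incrE; apply/ffunP => x; rewrite !ffunE eqxx; case: eqP => [->|].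
Qed.

Lemma whirl_neq p f x : x != p -> val (whirl F p f) x = val f x.
Proof. by move=> xp; rewrite whirl_updE ffunE (negPf xp). Qed.

Lemma whirl_min p f u d : 0 < d -> u = (val f p + d) %% K :> nat ->
  upd (val f) p u \in F ->
  exists2 m, 0 < m <= d & val (whirl F p f) p = (val f p + m) %% K :> nat.
Proof.
move=> d0 uE uF; rewrite permE; have [m [m0 -> mmin]] := whirl_funP p f.
exists m; last by rewrite iter_incrE ffunE eqxx val_iter_ordS.
rewrite m0 leqNgt; apply/negP => dm.
have := mmin d; rewrite d0 dm => /(_ isT)/negP[].
rewrite iter_incrE; congr (_ \in F): uF.
apply/ffunP => x; rewrite !ffunE; case: eqP => // ->.
by apply: val_inj; rewrite /= val_iter_ordS.
Qed.

Lemma whirl_succ p f u : u = (val f p).+1 :> nat ->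
  upd (val f) p u \in F -> val (whirl F p f) p = u.
Proof.
move=> uE uF; have uK := ltn_ord u.
have [||m m1 mE] := whirl_min (d := 1) _ _ uF => //.
  by rewrite addn1 -uE modn_small.
have {m1} m1 : m = 1 by lia.
by apply: val_inj; rewrite /= mE m1 addn1 -uE modn_small.
Qed.

(** The value 0 is reached after [K - val f p] additions, so an admissible 0 cannot be passed.
    Stopping sooner would leave a value above the old one. *)
Lemma whirl0 p f u : u = 0 :> nat -> upd (val f) p u \in F ->
  val (whirl F p f) p <= val f p -> val (whirl F p f) p = 0 :> nat.
Proof.
move=> u0 uF; have fK := ltn_ord (val f p).
have [||m /andP[m0 md] ->] := whirl_min (d := K - val f p) _ _ uF.
- by rewrite subn_gt0.
- by rewrite subnKC 1?ltnW // modnn.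
have [lt|ge] := ltnP (val f p + m) K; first by rewrite modn_small //; lia.
have -> : val f p + m = K by lia.
by rewrite modnn.
Qed.

End WhirlStep.

(** * Whirling at two adjacent positions *)

Section RGWhirl.

Variables (n K : nat) (s : bool) (F : {set {ffun 'I_n -> 'I_K}}).
Hypothesis FP : forall f, f \in F <-> rg_member s f.
Variables i j : 'I_n.
Hypotheses (i_gt0 : 0 < i) (ijS : j = i.+1 :> nat).
Implicit Types (f : {f | f \in F}) (p x y : 'I_n).

Let j_neq_i : j != i. Proof. by apply/eqP => E; move: ijS; rewrite E; lia. Qed.

Let i_neq_j : i != j. Proof. by rewrite eq_sym. Qed.

Lemma val_rg_member f : rg_member s (val f).
Proof. exact/FP/valP. Qed.

Lemma whirl_repeated_lt p y f : y < p -> val f y = val f p ->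
  (val f p).+1 < K -> val (whirl F p f) p = (val f p).+1 :> nat.
Proof.
move=> yp fy lt; rewrite (whirl_succ (u := Ordinal lt)) //.
exact/FP/(rg_member_upd_succ (val_rg_member f) yp fy).
Qed.

(** As [y] repeats the new value, 0 is admissible at [p] too, and a whirl that does not raise the
    value must have stopped there. *)
Lemma whirl_le_eq0 p y f : y != p -> y <= p.+1 ->
    val f y = val (whirl F p f) p -> val (whirl F p f) p <= val f p ->
  val (whirl F p f) p = 0 :> nat.
Proof.
move=> ypN yp fy le.
have K0 : 0 < K := leq_ltn_trans (leq0n _) (ltn_ord (val f p)).
apply: (whirl0 (u := Ordinal K0)) le => //; apply/FP.
apply: rg_member_upd0 ypN yp fy _ => //.
by rewrite -whirl_updE; apply: val_rg_member.
Qed.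

(** If the value at [i] occurs earlier, the whirl raises it by one. Otherwise [i] is its only
    occurrence before [j], whose larger value requires it, so the whirl must come back to it. *)
Lemma whirl_left_lt f : val f i < val f j ->
  0 < val (whirl F i f) i <= val f j.
Proof.
move=> ab; have [rf _] := val_rg_member f.
have [/existsP[y /andP[yi /eqP fy]]|nex] :=
  boolP [exists y : 'I_n, (y < i) && (val f y == val f i)].
  by rewrite (whirl_repeated_lt yi) // (leq_ltn_trans ab).
have new y : y < i -> val f y <> val f i.
  by move=> yi fy; case/existsP: nex; exists y; rewrite yi fy eqxx.
have -> : val (whirl F i f) i = val f i.
  have [rg _] := val_rg_member (whirl F i f).
  have [|y yj] := rg j (val f i); first by rewrite whirl_neq.
  have [->|yi] := eqVneq y i; first exact: val_inj.
  rewrite (whirl_neq f yi) => /val_inj fy; case: (new y) => //.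
  by rewrite ltn_neqAle yi -ltnS -ijS.
rewrite (ltnW ab) andbT lt0n; apply/eqP => a0.
have n0 : 0 < n := leq_ltn_trans (leq0n _) (ltn_ord i).
(* The first position carries 0 and precedes [i], so 0 is not new at [i]. *)
case: (new (Ordinal n0)) => //; apply: val_inj; rewrite /= a0; apply/eqP.
by rewrite -leqn0 leqNgt; apply/negP => /rf[].
Qed.

(** A new value at most that of [j] is at most the old one: if equal, [j] repeats it; if smaller, a
    position before [i] does. Either way it is 0. *)
Lemma whirl_left_ge f : val f j <= val f i ->
  val (whirl F i f) i = 0 :> nat \/ val f j < val (whirl F i f) i.
Proof.
move=> ba; have [|cb] := ltnP; [by right|left].
have ca := leq_trans cb ba; have [rf _] := val_rg_member f.
move: (ca); rewrite leq_eqVlt => /orP[/eqP/val_inj cE|/rf[y yi /val_inj fy]].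
  apply: (@whirl_le_eq0 i j) => //; first by rewrite ijS.
  by apply/val_inj/eqP; rewrite eqn_leq cb {1}cE ba.
apply: (@whirl_le_eq0 i y) => //; last by rewrite ltnW // ltnW.
by apply: contraTneq yi => ->; rewrite ltnn.
Qed.

Lemma whirl_right_ge f : val f i <= val f j ->
  val (whirl F j f) j = 0 :> nat \/ val f i < val (whirl F j f) j.
Proof.
move=> ab; have [|ca] := ltnP; [by right|left].
have cb := leq_trans ca ab; have [rf _] := val_rg_member f.
move: (cb); rewrite leq_eqVlt => /orP[/eqP/val_inj cE|/rf[y yj /val_inj fy]].
  apply: (@whirl_le_eq0 j i) => //; first by rewrite ijS ltnW.
  by apply/val_inj/eqP; rewrite eqn_leq ca andbT cE.
apply: (@whirl_le_eq0 j y) => //; last by rewrite ltnW // ltnW.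
by apply: contraTneq yj => ->; rewrite ltnn.
Qed.

(** Restricted growth at [i] puts the smaller value of [j] at a position before [i], so the whirl
    just adds one. *)
Lemma whirl_right_lt f : val f j < val f i ->
  0 < val (whirl F j f) j <= val f i.
Proof.
move=> ba; have [rf _] := val_rg_member f.
have [y yi /val_inj fy] := rf i _ ba.
rewrite (whirl_repeated_lt _ fy) ?(leq_ltn_trans ba) //.
by rewrite ijS ltnW.
Qed.

Local Open Scope ring_scope.

(** The strict and the weak comparison are the two potentials that telescope. *)
Let S f : rat := (val f i < val f j)%N%:R.
Let W f : rat := (val f i <= val f j)%N%:R.

Lemma I_to1_whirl_left f :
  I_to1 i (val (whirl F i f)) = W (whirl F i f) - S f.
Proof.
rewrite /I_to1 /W /S (whirl_neq f j_neq_i).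
have [ab|ba] := ltnP (val f i) (val f j).
  by have /andP[c0 ->] := whirl_left_lt ab; rewrite eqn0Ngt c0 subrr.
have [->|bc] := whirl_left_ge ba; first by rewrite leq0n subr0.
by rewrite leqNgt bc eqn0Ngt (leq_ltn_trans _ bc) // subr0.
Qed.

Lemma I_to1_whirl_right f :
  I_to1 j (val (whirl F j f)) = W f - S (whirl F j f).
Proof.
rewrite /I_to1 /W /S (whirl_neq f i_neq_j).
have [ab|ba] := leqP (val f i) (val f j).
  have [->|ac] := whirl_right_ge ab; first by rewrite ltn0 subr0.
  by rewrite ac eqn0Ngt (leq_ltn_trans _ ac) // subrr.
have /andP[c0 ca] := whirl_right_lt ba.
by rewrite ltnNge ca eqn0Ngt c0 subrr.
Qed.

(** * Telescoping along a word of whirls *)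

Definition whirl_seq (r : seq 'I_n) : {perm {f | f \in F}} :=
  (\prod_(p <- r) whirl F p)%g.

Lemma whirl_seq_notin r x f : x \notin r -> val (whirl_seq r f) x = val f x.
Proof.
rewrite /whirl_seq; elim: r f => [|p r IH] f; first by rewrite big_nil perm1.
rewrite big_cons inE negb_or permM => /andP[xp /IH ->].
exact: whirl_neq.
Qed.

Lemma whirl_seq_split r1 p r2 q r3 f :
  whirl_seq (r1 ++ p :: r2 ++ q :: r3) f =
  whirl_seq r3 (whirl F q (whirl_seq r2 (whirl F p (whirl_seq r1 f)))).
Proof. by rewrite /whirl_seq big_cat big_cons big_cat big_cons /= !permM. Qed.

Lemma I_to1_val_eq x f f' : val f x = val f' x ->
  I_to1 x (val f) = I_to1 x (val f').
Proof. by rewrite /I_to1 => ->. Qed.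

Lemma I_to1_whirl_seq r : uniq r -> i \in r -> j \in r ->
  exists Phi : {f | f \in F} -> rat, forall f,
    I_to1 i (val (whirl_seq r f)) - I_to1 j (val (whirl_seq r f)) =
    Phi (whirl_seq r f) - Phi f.
Proof.
move=> ur /splitPr rE; case: rE ur => s1 s2; rewrite mem_cat inE (negPf j_neq_i) /=.
move=> ur /orP[] /splitPr js.
  case: js ur => r1 r2; rewrite -catA cat_cons => ur.
  have [|i1 i2 i3] := uniq_split_notin (x := i) ur; first by rewrite !inE eqxx orbT.
  have [|j1 j2 j3] := uniq_split_notin (x := j) ur; first by rewrite !inE eqxx.
  (* With [j] whirled first, the strict terms cancel between the two whirls and the weak comparison
     survives. *)
  exists W => f; rewrite whirl_seq_split.
  set f1 := whirl_seq r1 f; set f2 := whirl F j f1; set f3 := whirl_seq r2 f2.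
  set f4 := whirl F i f3; set g := whirl_seq s2 f4.
  have gi : val g i = val f4 i by apply: whirl_seq_notin.
  have gj : val g j = val f4 j by apply: whirl_seq_notin.
  (* The final value at [j] is the one left by its own whirl, so its indicator can be read off at
     [f2]. *)
  have gj2 : val g j = val f2 j.
    by rewrite gj /f4 (whirl_neq _ j_neq_i) /f3 whirl_seq_notin.
  rewrite (I_to1_val_eq gi) (I_to1_val_eq gj2) I_to1_whirl_left I_to1_whirl_right.
  have -> : S f3 = S f2 by rewrite /S /f3 !whirl_seq_notin.
  have -> : W f1 = W f by rewrite /W /f1 !whirl_seq_notin.
  have -> : W g = W f4 by rewrite /W gi gj.
  by rewrite -/f2 -/f4; ring.
case: js ur => r2 r3 ur.
have [|i1 i2 i3] := uniq_split_notin (x := i) ur; first by rewrite !inE eqxx.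
have [|j1 j2 j3] := uniq_split_notin (x := j) ur; first by rewrite !inE eqxx orbT.
(* With [i] whirled first, the weak terms cancel instead. *)
exists S => f; rewrite whirl_seq_split.
set f1 := whirl_seq s1 f; set f2 := whirl F i f1; set f3 := whirl_seq r2 f2.
set f4 := whirl F j f3; set g := whirl_seq r3 f4.
have gi : val g i = val f4 i by apply: whirl_seq_notin.
have gj : val g j = val f4 j by apply: whirl_seq_notin.
have gi2 : val g i = val f2 i.
  by rewrite gi /f4 (whirl_neq _ i_neq_j) /f3 whirl_seq_notin.
rewrite (I_to1_val_eq gi2) (I_to1_val_eq gj) I_to1_whirl_left I_to1_whirl_right.
have -> : W f3 = W f2 by rewrite /W /f3 !whirl_seq_notin.
have -> : S f1 = S f by rewrite /S /f1 !whirl_seq_notin.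
have -> : S g = S f4 by rewrite /S gi gj.
by rewrite -/f2 -/f4; ring.
Qed.

End RGWhirl.

(** * Sums over an orbit *)

Section Orbits.

Local Open Scope ring_scope.

Lemma sum_porbit_shift (T : finType) (w : {perm T}) (O : {set T}) (h : T -> rat) :
  O \in porbits w -> \sum_(f in O) h (w f) = \sum_(f in O) h f.
Proof.
case/imsetP=> x _ ->; rewrite [RHS](reindex_inj (@perm_inj _ w)).
apply: eq_bigl => f; rewrite -!eq_porbit_mem.
by have := porbit_perm w 1 f; rewrite expg1 => ->.
Qed.

Variables (n K : nat) (s : bool) (F : {set {ffun 'I_n -> 'I_K}}).
Hypothesis FP : forall f, f \in F <-> rg_member s f.
Variable pi : {perm 'I_n}.
Hypothesis hpi : perm_on [set x : 'I_n | (0 < x)%N] pi.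
Variable O : {set {f | f \in F}}.
Hypothesis OP : O \in porbits (whirl_word F pi).

Implicit Types i j x : 'I_n.

Let total i : rat := \sum_(f in O) I_to1 i (val f).

Lemma whirl_word_seq : whirl_word F pi =
  whirl_seq F [seq pi x | x : 'I_n <- index_enum 'I_n & (0 < x)%N].
Proof.
by rewrite /whirl_word /whirl_seq big_map big_filter.
Qed.

Lemma total_adjacent i j : (0 < i)%N -> j = i.+1 :> nat -> total i = total j.
Proof.
move=> i0 ij; set r := [seq pi x | x : 'I_n <- index_enum 'I_n & (0 < x)%N].
have mem_r (x : 'I_n) : (0 < x)%N -> x \in r.
  move=> x0; apply/mapP; exists ((pi^-1)%g x); last by rewrite permKV.
  rewrite mem_filter mem_index_enum andbT.
  by have := perm_closed ((pi^-1)%g x) hpi; rewrite permKV !inE x0 => <-.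
have ur : uniq r.
  rewrite map_inj_uniq; last exact: perm_inj.
  by rewrite filter_uniq ?index_enum_uniq.
have j0 : (0 < j)%N by rewrite ij.
have [Phi PhiE] := I_to1_whirl_seq FP i0 ij ur (mem_r i i0) (mem_r j j0).
rewrite -/r -whirl_word_seq in PhiE.
apply/eqP; rewrite -subr_eq0 -sumrB.
(* Shifting the sum by the whirling word evaluates the indicators at the image of [f], where [PhiE]
   applies. *)
rewrite -(sum_porbit_shift (fun f => _ - _) OP) (eq_bigr _ (fun f _ => PhiE f)).
by rewrite sumrB (sum_porbit_shift Phi OP) subrr.
Qed.

Lemma total_const i j : (0 < i)%N -> (0 < j)%N -> total i = total j.
Proof.
wlog ij : i j / (i <= j)%N.
  by move=> H i0 j0; have [/H->|/ltnW/H->] := leqP i j.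
(* Induction on the value of [j], stepping down to its left neighbour, which is still at least [i]
   and hence positive. *)
move=> i0 _; move: {2}(j : nat) (erefl (j : nat)) => m.
elim: m j ij => [|m IH] j ij jm; first by lia.
have [E|ne] := eqVneq i j; first by rewrite E.
have mn : (m < n)%N by rewrite -jm ltnW.
have im : (i <= Ordinal mn)%N.
  have : (i < j)%N by rewrite ltn_neqAle ne.
  by rewrite jm.
rewrite (IH (Ordinal mn)) //; apply: total_adjacent => //=.
exact: leq_trans im.
Qed.

End Orbits.

Lemma whirl_word_homomesic n K s (F : {set {ffun 'I_n -> 'I_K}})
    (pi : {perm 'I_n}) (i j : 'I_n) :
    (forall f, f \in F <-> rg_member s f) ->
    perm_on [set x : 'I_n | 0 < x] pi -> 0 < i -> 0 < j ->
  homomesic (whirl_word F pi)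
    (fun f => I_to1 i (val f) - I_to1 j (val f))%R 0%R.
Proof.
move=> FP hpi i0 j0 O OP.
by rewrite sumrB (total_const FP hpi OP i0 j0) subrr mulr0.
Qed.

Theorem theorem3p8 (n : nat) (hn : 2 <= n)
    (pi : {perm 'I_n}) (hpi : perm_on [set x : 'I_n | 0 < x] pi)
    (i j : 'I_n) (hi : 0 < i) (hj : 0 < j) :
  homomesic (whirl_word (RG n) pi)
    (fun f => I_to1 i (val f) - I_to1 j (val f))%R 0%R
  /\ (forall k : nat, 1 <= k <= n ->
      homomesic (whirl_word (RGk n k) pi)
        (fun f => I_to1 i (val f) - I_to1 j (val f))%R 0%R).
Proof.
split=> [|k _]; apply: whirl_word_homomesic => //.
- exact: RG_memberP.
- exact: RGk_memberP.
Qed.
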